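(* Let $X$ and $Y$ be nonempty finite sets. For any two formigrams $\theta_X$ over $X$ and $\theta_Y$ over $Y$, $$d_{\mathrm I}^{\mathrm R}(\mathrm{Reeb}(\theta_X),\mathrm{Reeb}(\theta_Y))\le d_{\mathrm I}^{\mathrm F}(\theta_X,\theta_Y).$$
   Context: Subpartitions. A subpartition of $X$ is a partition $P$ of a (possibly empty) subset of $X$; its elements are blocks, $\bigcup P$ is its underlying set. $\mathrm{SubPart}(X)$ is the lattice of all subpartitions of $X$, ordered by $P\le Q$ iff every block of $P$ is contained in some block of $Q$; $P\vee Q$ is the finest common coarsening. Formigrams. A formigram over $X$ is a map $\theta_X:\mathbb{R}\to\mathrm{SubPart}(X)$ such that (a) there is a locally finite set $C\subset\mathbb{R}$ such that $\theta_X$ is constant on each connected component of $\mathbb{R}\setminus C$ and for every $c\in C$ there is $r_c>0$ with $\theta_X(c-\varepsilon)\le\theta_X(c)\ge\theta_X(c+\varepsilon)$ for all $\varepsilon\in[0,r_c)$; (b) for each $x\in X$ there is a (nonempty) closed interval $I_x\subset\mathbb{R}$ with $x\in\bigcup\theta_X(t)$ iff $t\in I_x$. Let $\mathbf{Int}$ be the poset of nonempty bounded closed real intervals ordered by inclusion, and $I^\varepsilon=[b-\varepsilon,d+\varepsilon]$ for $I=[b,d]$, $\varepsilon\ge0$. Write $\bigvee_I\theta_X=\bigvee\{\theta_X(t):t\in I\}$; thus $\theta_X$ is regarded as a functor (order-preserving map) $\mathbf{Int}\to\mathrm{SubPart}(X)$, $I\mapsto\bigvee_I\theta_X$. Tripods.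 A tripod $R$ between $X$ and $Y$ is a set $Z$ with surjections $\varphi_X:Z\to X$, $\varphi_Y:Z\to Y$. For a surjection $\varphi:Z\to X$, $\varphi^*\theta_X$ is the formigram over $Z$ with $(\varphi^*\theta_X)(t)=\{\varphi^{-1}(B):B\in\theta_X(t)\}$. For formigrams $\theta,\theta'$ over the same set $Z$, $d_{\mathrm I}^{\mathrm{SubPart}(Z)}(\theta,\theta')=\inf\{\varepsilon\ge0:\ \forall I\in\mathbf{Int},\ \bigvee_I\theta\le\bigvee_{I^\varepsilon}\theta'\text{ and }\bigvee_I\theta'\le\bigvee_{I^\varepsilon}\theta\}$. A tripod $R$ is an $\varepsilon$-tripod between $\theta_X$ and $\theta_Y$ if $d_{\mathrm I}^{\mathrm{SubPart}(Z)}(\varphi_X^*\theta_X,\varphi_Y^*\theta_Y)\le\varepsilon$. Then $d_{\mathrm I}^{\mathrm F}(\theta_X,\theta_Y)$ is the minimum (infimum) of those $\varepsilon\ge0$ for which an $\varepsilon$-tripod exists ($+\infty$ if none). Reeb graphs. $\mathrm{Reeb}(\theta_X):\mathbf{Int}\to\mathbf{set}$ is the functor sending $I$ to the set of blocks $\bigvee_I\theta_X$ and $I\subset J$ to the map sending a block of $\bigvee_I\theta_X$ to the unique block of $\bigvee_J\theta_X$ containing it. Two functors $F,G:\mathbf{Int}\to\mathbf{set}$ are $\varepsilon$-interleaved if there are maps $f_I:F(I)\to G(I^\varepsilon)$ and $g_I:G(I)\to F(I^\varepsilon)$, natural in $I$, with $g_{I^\varepsilon}\circ f_I=F(I\subset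 I^{2\varepsilon})$ and $f_{I^\varepsilon}\circ g_I=G(I\subset I^{2\varepsilon})$ for all $I$. $d_{\mathrm I}^{\mathrm R}(F,G)$ is the infimum of $\varepsilon\ge0$ such that $F,G$ are $\varepsilon$-interleaved ($+\infty$ if none). *)

(* Defs.v *)
From HB Require Import structures.
From Stdlib Require Import Relation_Operators.
From mathcomp Require Import all_boot all_order all_algebra.
From mathcomp Require Import all_classical all_reals all_analysis.

Set Implicit Arguments.
Unset Strict Implicit.
Unset Printing Implicit Defensive.

Import Order.TTheory GRing.Theory Num.Theory.
Import numFieldNormedType.Exports.

Local Open Scope classical_set_scope.
Local Open Scope ring_scope.

Record subpart (X : Type) := Subpart {
  blocks : set (set X);
  blocksP : exists A : set X, partition blocks id A }.

Definition support (X : Type) (P : subpart X) : set X := cover (blocks P) id.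

Definition subpart_le (X : Type) (P Q : subpart X) : Prop :=
  forall B, blocks P B -> exists2 C, blocks Q C & B `<=` C.

Section SubpartTheory.
Variable X : Type.
Implicit Types (P Q : subpart X) (F : set (subpart X)).

Lemma block_neq0 P B : blocks P B -> B !=set0.
Proof. by case: (blocksP P) => A [_ _]; apply. Qed.

Lemma block_eq P B C x : blocks P B -> blocks P C -> B x -> C x -> B = C.
Proof. by case: (blocksP P) => A [_ + _] PB PC Bx Cx; apply => //; exists x. Qed.

Lemma subpart_eq P Q : blocks P = blocks Q -> P = Q.
Proof.
case: P Q => [b p] [c q] /= bc; move: p q; rewrite bc => p q.
by congr Subpart; exact: Prop_irrelevance.
Qed.

Lemma subpart_le_refl P : subpart_le P P.
Proof. by move=> B PB; exists B. Qed.

Lemma subpart_le_trans Q P S :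
  subpart_le P Q -> subpart_le Q S -> subpart_le P S.
Proof.
move=> PQ QS B /PQ[C /QS[D SD CD] BC]; exists D => //; exact: subset_trans CD.
Qed.

Lemma subpart_le_blocks P Q :
  subpart_le P Q -> subpart_le Q P -> blocks P `<=` blocks Q.
Proof.
move=> PQ QP B PB; have [C QC BC] := PQ _ PB; have [D PD CD] := QP _ QC.
have [x Bx] := block_neq0 PB.
have BD : B = D by apply: (block_eq PB PD Bx); exact/CD/BC.
suff -> : B = C by [].
by apply/seteqP; split => //; rewrite BD.
Qed.

Lemma subpart_le_anti P Q : subpart_le P Q -> subpart_le Q P -> P = Q.
Proof.
by move=> PQ QP; apply: subpart_eq; apply/seteqP; split;
  exact: subpart_le_blocks.
Qed.

Lemma subpart_le_uniq P Q B C D : blocks P B -> blocks Q C -> blocks Q D ->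
  B `<=` C -> B `<=` D -> C = D.
Proof.
move=> PB QC QD BC BD; have [x Bx] := block_neq0 PB.
exact: (block_eq QC QD (BC _ Bx) (BD _ Bx)).
Qed.

(** The blocks of the join of a family are the classes of the transitive
    closure of "lying in a common block of some member of the family".
    [subpart_join_ub] and [subpart_join_lub] show that this is the least
    upper bound, i.e. the finest common coarsening. *)

Definition linked F (x y : X) : Prop :=
  exists2 P, F P & exists2 B, blocks P B & B x /\ B y.

Definition chained F : X -> X -> Prop := clos_trans X (linked F).

Definition join_blocks F : set (set X) :=
  [set B | exists2 x, chained F x x & B = [set y | chained F x y]].

Lemma chained_sym F x y : chained F x y -> chained F y x.
Proof.
elim=> [a b [P FP [B PB [Ba Bb]]]|a b c _ ba _ cb].
  by apply: t_step; exists P => //; exists B.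
exact: t_trans cb ba.
Qed.

Lemma join_blocksP F : exists A : set X, partition (join_blocks F) id A.
Proof.
exists (cover (join_blocks F) id); split => //.
- move=> B C [x xx ->] [y yy ->] [z [/= xz yz]].
  have xy : chained F x y := t_trans _ _ _ _ _ xz (chained_sym yz).
  apply/seteqP; split => u /= h.
    exact: t_trans (chained_sym xy) h.
  exact: t_trans xy h.
- by move=> B [x xx ->]; exists x.
Qed.

Definition subpart_join F : subpart X := Subpart (join_blocksP F).

Lemma subpart_join_ub F P : F P -> subpart_le P (subpart_join F).
Proof.
move=> FP B PB; have [x Bx] := block_neq0 PB.
exists [set y | chained F x y].
  by exists x => //; apply: t_step; exists P => //; exists B.
by move=> y By; apply: t_step; exists P => //; exists B.
Qed.

Lemma subpart_join_lub F Q :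
  (forall P, F P -> subpart_le P Q) -> subpart_le (subpart_join F) Q.
Proof.
move=> FQ B [x xx ->].
have same a b : chained F a b -> exists2 C, blocks Q C & C a /\ C b.
  elim=> [u v [P FP [D PD [Du Dv]]]|u v w _ [C QC [Cu Cv]] _ [D QD [Dv Dw]]].
    have [C QC DC] := FQ _ FP _ PD.
    by exists C => //; split; exact: DC.
  by exists C => //; split => //; rewrite (block_eq QC QD Cv Dv).
have [C QC [Cx _]] := same _ _ xx.
exists C => // y /= /same[D QD [Dx Dy]].
by rewrite (block_eq QC QD Cx Dx).
Qed.

Lemma subpart_join_mono F G :
  F `<=` G -> subpart_le (subpart_join F) (subpart_join G).
Proof.
by move=> FG; apply: subpart_join_lub => P FP; exact/subpart_join_ub/FG.
Qed.

End SubpartTheory.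

Section Pullback.
Variables (Z X : Type) (phi : Z -> X).
Hypothesis phi_surj : set_surj [set: Z] [set: X] phi.

Lemma subpart_pullbackP (P : subpart X) :
  exists A : set Z, partition (preimage phi @` blocks P) id A.
Proof.
exists (cover (preimage phi @` blocks P) id); split => //.
- move=> _ _ [B PB <-] [C PC <-] [z [/= Bz Cz]].
  by rewrite (block_eq PB PC Bz Cz).
- move=> _ [B PB <-]; have [x Bx] := block_neq0 PB.
  by have [z _ zx] := phi_surj (I : [set: X] x); exists z; rewrite /= zx.
Qed.

Definition subpart_pullback (P : subpart X) : subpart Z :=
  Subpart (subpart_pullbackP P).

Lemma subpart_pullback_le (P Q : subpart X) :
  subpart_le P Q -> subpart_le (subpart_pullback P) (subpart_pullback Q).
Proof.
move=> PQ _ [B PB <-]; have [C QC BC] := PQ _ PB.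
by exists (phi @^-1` C); [exists C|exact: preimage_subset].
Qed.

Lemma support_pullback (P : subpart X) :
  support (subpart_pullback P) = phi @^-1` support P.
Proof.
apply/seteqP; split => z.
  by move=> [_ [B PB <-] Bz]; exists B.
by move=> [B PB Bz]; exists (phi @^-1` B) => //; exists B.
Qed.

End Pullback.

Definition locally_finite (T : topologicalType) (C : set T) : Prop :=
  forall x : T, exists2 U, nbhs x U & finite_set (C `&` U).

Section Formigram.
Variables (R : realType).

Definition critical_condition (X : Type) (theta : R -> subpart X) : Prop :=
  exists C : set R, [/\ locally_finite C,
    forall s t, connected_component (~` C) s t -> theta s = theta t &
    forall c, C c -> exists2 r : R, 0 < r &
      forall e : R, 0 <= e < r ->
        subpart_le (theta (c - e)) (theta c) /\
        subpart_le (theta (c + e)) (theta c)].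

(* [is_interval] and [closed] also allow half-lines and the whole line. *)
Definition lifespan_condition (X : Type) (theta : R -> subpart X) : Prop :=
  forall x : X, exists I : set R,
    [/\ I !=set0, closed I, is_interval I &
        forall t, support (theta t) x <-> I t].

Record formigram (X : Type) := Formigram {
  formigram_fun :> R -> subpart X;
  formigram_critical : critical_condition formigram_fun;
  formigram_lifespan : lifespan_condition formigram_fun }.

Section FormigramPullback.
Variables (Z X : Type) (phi : Z -> X).
Hypothesis phi_surj : set_surj [set: Z] [set: X] phi.
Variable theta : formigram X.

Let pb (t : R) : subpart Z := subpart_pullback phi_surj (theta t).

Lemma pullback_critical : critical_condition pb.
Proof.
have [C [Cfin Ccst Cmax]] := formigram_critical theta.
exists C; split => // [s t /Ccst st|c /Cmax[r r0 rP]].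
  by rewrite /pb st.
exists r => // e /rP[le1 le2]; split; exact: subpart_pullback_le.
Qed.

Lemma pullback_lifespan : lifespan_condition pb.
Proof.
move=> z; have [I [I0 Icl Iitv IP]] := formigram_lifespan theta (phi z).
by exists I; split => // t; rewrite support_pullback; exact: IP.
Qed.

Definition formigram_pullback : formigram Z :=
  Formigram pullback_critical pullback_lifespan.

End FormigramPullback.

Record cint := Cint { lo : R; hi : R; lo_le_hi : lo <= hi }.

Definition cint_set (I : cint) : set R := `[lo I, hi I]%classic.
Coercion cint_set : cint >-> set.

Lemma thicken_subproof (e : {nonneg R}) (I : cint) :
  lo I - e%:num <= hi I + e%:num.
Proof.
apply: (@le_trans _ _ (lo I)); first by rewrite gerBl.
by apply: (le_trans (lo_le_hi I)); rewrite lerDl.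
Qed.

Definition thicken (e : {nonneg R}) (I : cint) : cint :=
  Cint (thicken_subproof e I).

Lemma cint_subsetE (I J : cint) :
  (I `<=` J) <-> (lo J <= lo I) /\ (hi I <= hi J).
Proof.
split=> [IJ|[l h] x].
  have Il : cint_set I (lo I) by rewrite /cint_set /= in_itv /= lexx lo_le_hi.
  have Ih : cint_set I (hi I) by rewrite /cint_set /= in_itv /= lexx lo_le_hi.
  move: (IJ _ Il) (IJ _ Ih); rewrite /cint_set /= !in_itv /=.
  by move=> /andP[-> _] /andP[_ ->].
rewrite /cint_set /= !in_itv /= => /andP[lx xh].
by rewrite (le_trans l lx) (le_trans xh h).
Qed.

Lemma cint_eq (I J : cint) : lo I = lo J -> hi I = hi J -> I = J.
Proof.
case: I J => [a b ab] [c d cd] /= ac bd; move: ab cd; rewrite ac bd => ab cd.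
by congr Cint; exact: bool_irrelevance.
Qed.

Lemma subset_thicken (e : {nonneg R}) (I : cint) : I `<=` thicken e I.
Proof. by apply/cint_subsetE; rewrite /= gerBl lerDl. Qed.

Lemma thicken_mono (e : {nonneg R}) (I J : cint) :
  I `<=` J -> thicken e I `<=` thicken e J.
Proof.
by move=> /cint_subsetE[l h]; apply/cint_subsetE; rewrite /= lerB // lerD.
Qed.

Lemma thicken_thicken (e : {nonneg R}) (I : cint) :
  thicken e (thicken e I) = thicken (2 * e%:num)%:nng I.
Proof.
by apply: cint_eq => /=; rewrite mulr_natl mulr2n ?opprD addrA.
Qed.

Lemma subset_thicken2 (e : {nonneg R}) (I : cint) :
  I `<=` thicken e (thicken e I).
Proof. rewrite thicken_thicken; exact: subset_thicken. Qed.

Definition join_over (X : Type) (theta : R -> subpart X) (I : cint) :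
    subpart X :=
  subpart_join [set theta t | t in (I : set R)].

Lemma join_over_mono (X : Type) (theta : R -> subpart X) (I J : cint) :
  I `<=` J -> subpart_le (join_over theta I) (join_over theta J).
Proof. by move=> IJ; apply: subpart_join_mono; exact: image_subset. Qed.

Definition dI_SubPart (Z : Type) (theta theta' : formigram Z) : \bar R :=
  ereal_inf [set (e%:num)%:E | e in [set e : {nonneg R} |
    forall I : cint,
      subpart_le (join_over theta I) (join_over theta' (thicken e I)) /\
      subpart_le (join_over theta' I) (join_over theta (thicken e I))]].

Record tripod (X Y : Type) := Tripod {
  apex : Type;
  legX : apex -> X;
  legY : apex -> Y;
  legX_surj : set_surj [set: apex] [set: X] legX;
  legY_surj : set_surj [set: apex] [set: Y] legY }.

Definition is_eps_tripod (X Y : Type) (thetaX : formigram X)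
    (thetaY : formigram Y) (e : {nonneg R}) (T : tripod X Y) : Prop :=
  (dI_SubPart (formigram_pullback (legX_surj T) thetaX)
              (formigram_pullback (legY_surj T) thetaY) <= (e%:num)%:E)%E.

Definition dI_F (X Y : Type) (thetaX : formigram X) (thetaY : formigram Y) :
    \bar R :=
  ereal_inf [set (e%:num)%:E | e in [set e : {nonneg R} |
    exists T : tripod X Y, is_eps_tripod thetaX thetaY e T]].

Record int_functor := IntFunctor {
  fobj : cint -> Type;
  fmap : forall I J : cint, I `<=` J -> fobj I -> fobj J;
  fmap_id : forall (I : cint) (h : I `<=` I) x, fmap h x = x;
  fmap_comp : forall (I J K : cint) (hIJ : I `<=` J) (hJK : J `<=` K)
    (hIK : I `<=` K) x, fmap hIK x = fmap hJK (fmap hIJ x) }.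

(** The maps [F(I) -> F(I^{2e})] are written with target
    [F((I^e)^e)], see [thicken_thicken]. *)
Definition interleaved (e : {nonneg R}) (F G : int_functor) : Prop :=
  exists (f : forall I, fobj F I -> fobj G (thicken e I))
         (g : forall I, fobj G I -> fobj F (thicken e I)),
    [/\ forall (I J : cint) (h : I `<=` J) x,
          f J (fmap h x) = fmap (@thicken_mono e I J h) (f I x),
        forall (I J : cint) (h : I `<=` J) x,
          g J (fmap h x) = fmap (@thicken_mono e I J h) (g I x),
        forall I x, g (thicken e I) (f I x) = fmap (@subset_thicken2 e I) x &
        forall I x, f (thicken e I) (g I x) = fmap (@subset_thicken2 e I) x].

Definition dI_R (F G : int_functor) : \bar R :=
  ereal_inf [set (e%:num)%:E | e in [set e : {nonneg R} | interleaved e F G]].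

Definition block_of (X : Type) (P : subpart X) : Type :=
  {B : set X | blocks P B}.

Lemma block_map_subproof (X : Type) (P Q : subpart X) (PQ : subpart_le P Q)
    (B : block_of P) : exists C : block_of Q, sval B `<=` sval C.
Proof. by have [C QC BC] := PQ _ (svalP B); exists (exist _ C QC). Qed.

(** The block chosen here is the only one containing [B], by
    [block_map_uniq]. *)
Definition block_map (X : Type) (P Q : subpart X) (PQ : subpart_le P Q)
    (B : block_of P) : block_of Q :=
  sval (cid (block_map_subproof PQ B)).

Lemma block_map_sub (X : Type) (P Q : subpart X) (PQ : subpart_le P Q)
  (B : block_of P) : sval B `<=` sval (block_map PQ B).
Proof. by rewrite /block_map; case: cid. Qed.

Lemma block_map_uniq (X : Type) (P Q : subpart X) (PQ : subpart_le P Q)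
  (B : block_of P) (C : block_of Q) : sval B `<=` sval C -> block_map PQ B = C.
Proof.
move=> BC; have := @block_map_sub X P Q PQ B; case: (block_map PQ B) C BC => [D QD] [C QC] /=.
move=> BC BD; apply: eq_exist.
exact: (subpart_le_uniq (svalP B) QD QC BD BC).
Qed.

Section Reeb.
Variables (X : Type) (theta : formigram X).

Definition reeb_obj (I : cint) : Type := block_of (join_over theta I).

Definition reeb_map (I J : cint) (h : I `<=` J) : reeb_obj I -> reeb_obj J :=
  block_map (@join_over_mono X theta I J h).

Lemma reeb_map_id (I : cint) (h : I `<=` I) x : reeb_map h x = x.
Proof. exact: block_map_uniq. Qed.

Lemma reeb_map_comp (I J K : cint) (hIJ : I `<=` J) (hJK : J `<=` K)
  (hIK : I `<=` K) x : reeb_map hIK x = reeb_map hJK (reeb_map hIJ x).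
Proof.
apply: block_map_uniq => y xy; rewrite /reeb_map.
by do 2! apply: block_map_sub.
Qed.

Definition Reeb : int_functor := IntFunctor reeb_map_id reeb_map_comp.

End Reeb.

End Formigram.

(* Main.v *)
Require Import Defs.
From Stdlib Require Import Relation_Operators.
From mathcomp Require Import all_boot all_order all_algebra.
From mathcomp Require Import all_classical all_reals all_analysis.

(** Pulling back along a surjection commutes with joins of subpartitions, because
    a chain of linked points downstairs lifts to a chain upstairs with
    prescribed endpoints. So, on a tripod with legs [phi] and [psi], an inequality
    between the joins of the pullbacks sends each block [B] of the join of
    [thetaX] over [I] to the only block [C] of the join of [thetaY] over
    [thicken e I] such that [phi @^-1` B `<=` psi @^-1` C]. Uniqueness of [C]
    gives naturality and the two interleaving identities. *)

Set Implicit Arguments.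
Unset Strict Implicit.
Unset Printing Implicit Defensive.

Import Order.TTheory.

Local Open Scope classical_set_scope.
Local Open Scope ring_scope.

Section PullbackJoin.
Variables (Z X : Type) (phi : Z -> X).
Hypothesis phi_surj : set_surj [set: Z] [set: X] phi.

Lemma linked_pullback (F : set (subpart X)) (z w : Z) :
  linked (subpart_pullback phi_surj @` F) z w <-> linked F (phi z) (phi w).
Proof.
split=> [[_ [P FP <-] [_ [B PB <-] [zB wB]]]|[P FP [B PB [zB wB]]]].
  by exists P => //; exists B.
exists (subpart_pullback phi_surj P); first by exists P.
by exists (phi @^-1` B) => //; exists B.
Qed.

Lemma chained_pullback (F : set (subpart X)) (z w : Z) :
  chained (subpart_pullback phi_surj @` F) z w <-> chained F (phi z) (phi w).
Proof.
split=> [|xy].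
  elim=> [a b /linked_pullback|a b c _ ab _ bc]; first exact: t_step.
  exact: t_trans ab bc.
(* The lifts of the endpoints are quantified inside the induction: when a chain is cut at [b], any
   preimage [v] of [b] can then end one half and start the other. *)
suff lift x y : chained F x y -> forall z w, phi z = x -> phi w = y ->
    chained (subpart_pullback phi_surj @` F) z w by exact: lift xy _ _ _ _.
elim=> {z w xy} [a b ab z w za wb|a b c _ IHab _ IHbc z w za wc].
  by apply/t_step/linked_pullback; rewrite za wb.
have [v _ vb] := phi_surj (I : [set: X] b).
by apply: (t_trans _ _ _ v); [exact: IHab|exact: IHbc].
Qed.

Lemma subpart_pullback_join (F : set (subpart X)) :
  subpart_join (subpart_pullback phi_surj @` F) =
  subpart_pullback phi_surj (subpart_join F).
Proof.
(* Blocks of a join are classes of a representative, so it suffices to match the class of [phi z]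
   with that of [z]; surjectivity lifts any representative in [X]. *)
have preimE z : phi @^-1` [set y | chained F (phi z) y] =
    [set w | chained (subpart_pullback phi_surj @` F) z w].
  by apply/seteqP; split=> w /= /chained_pullback.
apply: subpart_eq; apply/seteqP; split=> [_ [z zz ->]|_ [_ [x xx ->] <-]].
  exists [set y | chained F (phi z) y]; last exact: preimE.
  by exists (phi z) => //; exact/chained_pullback.
have [z _ zx] := phi_surj (I : [set: X] x); exists z; last by rewrite -zx preimE.
by apply/chained_pullback; rewrite zx.
Qed.

Lemma join_over_pullback (R : realType) (theta : formigram R X) (I : cint R) :
  join_over (formigram_pullback phi_surj theta) I =
  subpart_pullback phi_surj (join_over theta I).
Proof. by rewrite /join_over -subpart_pullback_join image_comp. Qed.

End PullbackJoin.

Section BlockTransfer.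
Variables (Z X Y : Type) (phi : Z -> X) (psi : Z -> Y).
Hypothesis phi_surj : set_surj [set: Z] [set: X] phi.
Hypothesis psi_surj : set_surj [set: Z] [set: Y] psi.

(** Blocks are nonempty and [phi] is onto, so some [z] lies over [B]; then [psi z] is common to [C]
    and [D]. *)
Lemma preimage_subset_block_uniq (P : subpart X) (Q : subpart Y)
    (B : block_of P) (C D : block_of Q) :
  phi @^-1` sval B `<=` psi @^-1` sval C ->
  phi @^-1` sval B `<=` psi @^-1` sval D -> C = D.
Proof.
case: B C D => [B PB] [C QC] [D QD] /= BC BD; apply: eq_exist.
have [x Bx] := block_neq0 PB; have [z _ zx] := phi_surj (I : [set: X] x).
have Bz : (phi @^-1` B) z by rewrite /= zx.
exact: (block_eq QC QD (BC _ Bz) (BD _ Bz)).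
Qed.

Lemma pullback_le_block (P : subpart X) (Q : subpart Y) :
  subpart_le (subpart_pullback phi_surj P) (subpart_pullback psi_surj Q) ->
  forall B : block_of P,
    exists C : block_of Q, phi @^-1` sval B `<=` psi @^-1` sval C.
Proof.
move=> PQ [B PB]; have [|_ [C QC <-] BC] := PQ (phi @^-1` B); first by exists B.
by exists (exist _ C QC).
Qed.

Variables (R : realType) (thetaX : formigram R X) (thetaY : formigram R Y).
Variable e : {nonneg R}.

(** Only the inclusion of preimages is recorded about the chosen [f], since it already determines
    each [f I B]. *)
Lemma reeb_transfer :
  (forall I : cint R, subpart_le
     (join_over (formigram_pullback phi_surj thetaX) I)
     (join_over (formigram_pullback psi_surj thetaY) (thicken e I))) ->
  exists f : forall I, reeb_obj thetaX I -> reeb_obj thetaY (thicken e I),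
    forall I B, phi @^-1` sval B `<=` psi @^-1` sval (f I B).
Proof.
move=> le_join; have trans I (B : reeb_obj thetaX I) :
    exists C : reeb_obj thetaY (thicken e I),
      phi @^-1` sval B `<=` psi @^-1` sval C.
  by apply: pullback_le_block; rewrite -!join_over_pullback.
by exists (fun I B => sval (cid (trans I B))) => I B; case: cid.
Qed.

Lemma reeb_transfer_natural
    (f : forall I, reeb_obj thetaX I -> reeb_obj thetaY (thicken e I)) :
  (forall I B, phi @^-1` sval B `<=` psi @^-1` sval (f I B)) ->
  forall (I J : cint R) (h : I `<=` J) B,
    f J (reeb_map h B) = reeb_map (@thicken_mono R e I J h) (f I B).
Proof.
(* Both ways around the square give a block whose [psi]-preimage contains the [phi]-preimage of
   [B]. *)
move=> fP I J h B; apply: (@preimage_subset_block_uniq _ _ B) => z Bz.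
  by apply: fP; exact: block_map_sub Bz.
by apply: block_map_sub; exact: fP.
Qed.

End BlockTransfer.

Lemma reeb_transferK (Z X Y : Type) (phi : Z -> X) (psi : Z -> Y)
    (phi_surj : set_surj [set: Z] [set: X] phi) (R : realType)
    (thetaX : formigram R X) (thetaY : formigram R Y) (e : {nonneg R})
    (f : forall I, reeb_obj thetaX I -> reeb_obj thetaY (thicken e I))
    (g : forall I, reeb_obj thetaY I -> reeb_obj thetaX (thicken e I)) :
  (forall I B, phi @^-1` sval B `<=` psi @^-1` sval (f I B)) ->
  (forall I C, psi @^-1` sval C `<=` phi @^-1` sval (g I C)) ->
  forall I B, g (thicken e I) (f I B) = reeb_map (@subset_thicken2 R e I) B.
Proof.
move=> fP gP I B.
(* The round trip ends over [X] again, so uniqueness is used with [phi] as both legs. *)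
apply: (preimage_subset_block_uniq phi_surj (psi := phi) (B := B)) => z Bz.
  by apply: gP; exact: fP.
exact: block_map_sub Bz.
Qed.

Lemma interleaved_Reeb (R : realType) (X Y : Type) (thetaX : formigram R X)
    (thetaY : formigram R Y) (T : tripod X Y) (e : {nonneg R}) :
  let pX := formigram_pullback (legX_surj T) thetaX in
  let pY := formigram_pullback (legY_surj T) thetaY in
  (forall I : cint R,
    subpart_le (join_over pX I) (join_over pY (thicken e I)) /\
    subpart_le (join_over pY I) (join_over pX (thicken e I))) ->
  interleaved e (Reeb thetaX) (Reeb thetaY).
Proof.
move=> pX pY le_join.
have [f fP] := reeb_transfer (fun I => (le_join I).1).
have [g gP] := reeb_transfer (fun I => (le_join I).2).
exists f, g; split.
- move=> I J h B; exact: (reeb_transfer_natural (legX_surj T) fP).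
- move=> I J h B; exact: (reeb_transfer_natural (legY_surj T) gP).
- move=> I B; exact: (reeb_transferK (legX_surj T) fP gP).
- move=> I B; exact: (reeb_transferK (legY_surj T) gP fP).
Qed.

Theorem proposition4p13 (R : realType) (X Y : finType)
    (hX : (0 < #|X|)%N) (hY : (0 < #|Y|)%N)
    (thetaX : formigram R X) (thetaY : formigram R Y) :
  (dI_R (Reeb thetaX) (Reeb thetaY) <= dI_F thetaX thetaY)%E.
Proof.
apply: le_ereal_inf_tmp => _ [e [T eT] <-].
(* The bound [eT] concerns an infimum that is not assumed to be attained at [e]. Hence infima are
   compared: every [d] admissible for the two pullbacks yields a [d]-interleaving. *)
apply: le_trans eT; apply: ereal_inf_le_tmp; apply: image_subset => d.
exact: interleaved_Reeb.
Qed.
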